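(* Let $p\in\mathbb{N}$, let $\mathbf{f}_1,\dots,\mathbf{f}_p$ be non-zero elements of $\ell^2(\Lambda,\mathcal{M}_n)$, and suppose that $\{\mathcal{D}_{2N\lambda}\mathbf{f}_j\}_{\lambda\in\Lambda,\,1\le j\le p}$ is a matrix-valued discrete Bessel sequence of non-uniform shifts in $\ell^2(\Lambda,\mathcal{M}_n)$ with Bessel bound $b_0$. Then, for a.e. $x\in\Omega$ and every $j\in\{1,\dots,p\}$, $$\left\|\mathcal{F}(\mathbf{f}_j)(x)\right\|_{\mathcal{M}_n}\le N+b_0.$$
   Context: Fix $n,N\in\mathbb{N}$ (positive integers) and an odd integer $r$ coprime to $N$ with $1\le r\le 2N-1$. Put $\Lambda=\{0,\frac{r}{N}\}+2\mathbb{Z}\subset\mathbb{R}$ and $\Omega=[0,\frac12)\cup[\frac N2,\frac{N+1}{2})$. $\mathcal{M}_n$ is the space of complex $n\times n$ matrices with norm $\|\mathbf{a}\|_{\mathcal{M}_n}=\big(\sum_{m,k=1}^n|a_{m,k}|^2\big)^{1/2}$. $\ell^2(\Lambda,\mathcal{M}_n)$ is the Hilbert space of maps $\mathbf{f}:\Lambda\to\mathcal{M}_n$ with $\sum_{\lambda\in\Lambda}\sum_{m,k=1}^n|f_{m,k}(\lambda)|^2<\infty$, with inner product $\langle\mathbf{f},\mathbf{g}\rangle=\sum_{\lambda\in\Lambda}\sum_{m,k=1}^n f_{m,k}(\lambda)\overline{g_{m,k}(\lambda)}$ and associated norm $\|\cdot\|_{\ell^2}$. $L^2(\Omega,\mathcal{M}_n)$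 is the Hilbert space of $\mathcal{M}_n$-valued functions on $\Omega$ with entries in $L^2(\Omega)$ and inner product $\sum_{m,k}\int_\Omega F_{m,k}(x)\overline{G_{m,k}(x)}\,dx$. The Fourier transform $\mathcal{F}:\ell^2(\Lambda,\mathcal{M}_n)\to L^2(\Omega,\mathcal{M}_n)$ is defined entrywise by $\mathcal{F}(\mathbf{f})_{m,k}(x)=\sum_{\lambda\in\Lambda}f_{m,k}(\lambda)e^{2\pi i\lambda x}$ (convergence in $L^2(\Omega)$; $\{e^{2\pi i\lambda\cdot}\}_{\lambda\in\Lambda}$ is a complete orthonormal system of $L^2(\Omega)$). For $\lambda\in\Lambda$, the displacement operator $\mathcal{D}_{2N\lambda}$ on $\ell^2(\Lambda,\mathcal{M}_n)$ is $(\mathcal{D}_{2N\lambda}\mathbf{f})(\lambda')=\mathbf{f}(\lambda'-2N\lambda)$, $\lambda'\in\Lambda$. For non-zero $\mathbf{f}_1,\dots,\mathbf{f}_p\in\ell^2(\Lambda,\mathcal{M}_n)$, the collection $\{\mathcal{D}_{2N\lambda}\mathbf{f}_j\}_{\lambda\in\Lambda,\,1\le j\le p}$ is a matrix-valued discrete Bessel sequence of non-uniform shifts with Bessel bound $b_0\in(0,\infty)$ if $\sum_{j=1}^p\sum_{\lambda\in\Lambda}|\langle\mathbf{f},\mathcal{D}_{2N\lambda}\mathbf{f}_j\rangle|^2\le b_0\|\mathbf{f}\|_{\ell^2}^2$ for all $\mathbf{f}\in\ell^2(\Lambda,\mathcal{M}_n)$. *)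

(* Defs.v *)
From HB Require Import structures.
From mathcomp Require Import all_boot all_order all_algebra finmap.
From mathcomp Require Import complex ring.
From mathcomp Require Import all_classical all_reals all_analysis.
From mathcomp Require summability.

Set Implicit Arguments.
Unset Strict Implicit.
Unset Printing Implicit Defensive.

Import Order.TTheory GRing.Theory Num.Theory.
Import numFieldNormedType.Exports.

Local Open Scope classical_set_scope.
Local Open Scope ring_scope.
Local Open Scope complex_scope.

Definition Lambda (R : realType) (N r : nat) : set R :=
  [set a + 2 * m%:~R | a in [set 0; r%:R / N%:R] & m in [set: int]].
Arguments Lambda : clear implicits.

Definition Omega (R : realType) (N : nat) : set R :=
  `[0, 1 / 2[ `|` `[N%:R / 2, (N%:R + 1) / 2[.
Arguments Omega : clear implicits.

Definition cabs (R : realType) (z : R[i]) : R := ComplexField.Normc.normc z.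

Definition mxFnorm (R : realType) (n : nat) (a : 'M[R[i]]_n) : R :=
  Num.sqrt (\sum_m \sum_k cabs (a m k) ^+ 2).

Definition ell2 (R : realType) (N r n : nat)
    (f : Lambda R N r -> 'M[R[i]]_n) : Prop :=
  (\esum_(l in [set: Lambda R N r])
     (\sum_m \sum_k cabs (f l m k) ^+ 2)%:E < +oo)%E.

(* The series over Lambda is summed along the net of finite subsets of Lambda;
   it converges absolutely when f and g are square summable. *)
Definition ell2_inner (R : realType) (N r n : nat)
    (f g : Lambda R N r -> 'M[R[i]]_n) : R[i] :=
  summability.sum (K := R[i]) (R := R[i]^o)
    (fun l : Lambda R N r => \sum_m \sum_k f l m k * (g l m k)^*).

Definition ell2_norm (R : realType) (N r n : nat)
    (f : Lambda R N r -> 'M[R[i]]_n) : R :=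
  Num.sqrt (complex.Re (ell2_inner f f)).

Lemma Lambda_shift (R : realType) (N r : nat) (l l' : R) :
  Lambda R N r l -> Lambda R N r l' -> Lambda R N r (l' - 2 * N%:R * l).
Proof.
move=> [a ha [m _ <-]] [a' ha' [m' _ <-]].
have [q hq] : exists q : int, N%:R * a = q%:~R :> R.
  case: ha => ->; first by exists 0; rewrite mulr0.
  have [->|N0] := eqVneq N 0%N; first by exists 0; rewrite mul0r.
  by exists r%:Z; rewrite mulrC divfK ?pnatr_eq0.
exists a' => //; exists (m' - q - 2 * N%:Z * m) => //.
by rewrite !rmorphB !rmorphM /= -hq; ring.
Qed.

Definition displacement (R : realType) (N r n : nat) (l : Lambda R N r)
    (f : Lambda R N r -> 'M[R[i]]_n) : Lambda R N r -> 'M[R[i]]_n :=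
  fun l' => f (exist _ (val l' - 2 * N%:R * val l)
    (mem_set (Lambda_shift (set_mem (valP l)) (set_mem (valP l'))))).

Definition expi (R : realType) (t : R) : R[i] := cos t +i* sin t.

Definition sq_integrable (R : realType) (N : nat) (F : R -> R[i]) : Prop :=
  [/\ measurable_fun (Omega R N) (fun x => complex.Re (F x)),
      measurable_fun (Omega R N) (fun x => complex.Im (F x)) &
      (\int[lebesgue_measure]_(x in Omega R N) (cabs (F x) ^+ 2)%:E < +oo)%E].

(* F represents the L^2 class of the Fourier transform of f, that is, the
   L^2(Omega)-limit of the partial sums over finite subsets of Lambda; F is
   determined only up to a null subset of Omega. *)
Definition is_fourier_transform (R : realType) (N r n : nat)
    (f : Lambda R N r -> 'M[R[i]]_n) (F : R -> 'M[R[i]]_n) : Prop :=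
  forall m k : 'I_n,
    sq_integrable N (fun x => F x m k) /\
    (fun A : {fset Lambda R N r} =>
       (\int[lebesgue_measure]_(x in Omega R N)
         (cabs (F x m k - summability.partial_sum
            (fun l : Lambda R N r => f l m k * expi (2 * pi * val l * x)) A)
          ^+ 2)%:E)%E) @ summability.totally --> 0%E.

Definition is_bessel_sequence (R : realType) (N r n p : nat)
    (fs : 'I_p -> Lambda R N r -> 'M[R[i]]_n) (b0 : R) : Prop :=
  0 < b0 /\
  forall f : Lambda R N r -> 'M[R[i]]_n, ell2 f ->
    (\sum_(j < p) \esum_(l in [set: Lambda R N r])
       (cabs (ell2_inner f (displacement l (fs j))) ^+ 2)%:E
     <= (b0 * ell2_norm f ^+ 2)%:E)%E.

(* Main.v *)
Require Import Defs.
From mathcomp Require Import all_boot all_order all_algebra finmap.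
From mathcomp Require Import complex ring lra.
From mathcomp Require Import all_classical all_reals all_analysis.
From mathcomp Require Import measurable_realfun.
From mathcomp Require summability.

Set Implicit Arguments.
Unset Strict Implicit.
Unset Printing Implicit Defensive.

Import Order.TTheory GRing.Theory Num.Theory.
Import numFieldNormedType.Exports.
Local Open Scope classical_set_scope.
Local Open Scope ring_scope.

(** On the Fourier side, the displacement by 2N times the element 2m of Lambda
    is the multiplication of F(f_j) by the character of frequency 4Nm.
    Let W be the squared Frobenius norm of F(f_j). The proof shows W <= 4 N b0
    almost everywhere on Omega, and 4 N b0 <= (N + b0)^2 is the inequality of
    arithmetic and geometric means.

    By duality the Bessel inequality bounds the synthesis operator: a finite
    combination of displaced copies of f_j with coefficients c has squared norm
    at most b0 times the squared norm of c ([synthesis_bound]). Since the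
    exponentials indexed by Lambda are orthonormal on Omega
    ([integral_cabs2_trigpoly]), for every y the Dirichlet kernel
    D_Q(v) = sum_(m < Q) exp(2 pi i m v) satisfies
      int_Omega |D_Q(4N(x - y))|^2 W(x) dx <= b0 Q
    ([modulated_energy_le]). The Fourier transform is only an L^2 limit, so this
    is obtained by truncating f_j to a finite set and controlling the error.

    The functions |D_Q(v - q/Q)|^2 / Q^2, for 0 <= q < Q, sum to 1
    ([dirichlet_partition]), and each is small away from q/Q modulo 1
    ([dirichlet_tail]). Adding the inequalities above over the points y of a grid
    of step 1/(4NQ) that lie near an interval I, and letting Q tend to infinity,
    gives int_I W <= 4 N b0 |I| ([integral_window_le]). Lebesgue's
    differentiation theorem then turns this into a pointwise bound
    ([ae_le_of_integral_window_le]). *)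

(** * Squared moduli and unit complex numbers *)

Section ComplexModulus.
Local Open Scope complex_scope.
Context {R : realType}.
Implicit Types (z w : R[i]) (s t : R).

Lemma cabs2E z : cabs z ^+ 2 = complex.Re z ^+ 2 + complex.Im z ^+ 2.
Proof. by case: z => a b; rewrite /cabs /= sqr_sqrtr// addr_ge0 ?sqr_ge0. Qed.

Lemma cabs2M z w : cabs (z * w) ^+ 2 = cabs z ^+ 2 * cabs w ^+ 2.
Proof. by rewrite /cabs ComplexField.Normc.normcM exprMn. Qed.

Lemma cabs2_mulJ z : (cabs z ^+ 2)%:C = z * z^*.
Proof.
rewrite cabs2E; case: z => a b; apply/eqP; rewrite eq_complex /=.
by apply/andP; split; apply/eqP; ring.
Qed.

Lemma cabs20 : cabs (0 : R[i]) ^+ 2 = 0.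
Proof. by rewrite cabs2E /= !expr0n /= addr0. Qed.

Lemma Re_sum I (s : seq I) (P : pred I) (F : I -> R[i]) :
  complex.Re (\sum_(i <- s | P i) F i) = \sum_(i <- s | P i) complex.Re (F i).
Proof. by elim/big_rec2: _ => // i u v _ <-; case: (F i) => a b; case: v. Qed.

Lemma cabs2_sumE I (s : seq I) (F : I -> R[i]) :
  cabs (\sum_(i <- s) F i) ^+ 2 =
  \sum_(i <- s) \sum_(j <- s) complex.Re (F i * (F j)^*).
Proof.
rewrite -[LHS]/(complex.Re (cabs (\sum_(i <- s) F i) ^+ 2)%:C) cabs2_mulJ.
rewrite rmorph_sum /= mulr_suml Re_sum; apply: eq_bigr => i _.
by rewrite mulr_sumr Re_sum.
Qed.

(** The weight e is left free: taking e small makes w a perturbation of z at a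
    cost that tends to 0, which replaces Minkowski's inequality. *)
Lemma cabs2D_le (e : R) z w : 0 < e ->
  cabs (z + w) ^+ 2 <= (1 + e) * cabs z ^+ 2 + (1 + e^-1) * cabs w ^+ 2.
Proof.
move=> e0; rewrite !cabs2E; case: z w => a b [c d] /=.
have key x y : (x + y) ^+ 2 <= (1 + e) * x ^+ 2 + (1 + e^-1) * y ^+ 2.
  rewrite -subr_ge0.
  suff -> : (1 + e) * x ^+ 2 + (1 + e^-1) * y ^+ 2 - (x + y) ^+ 2 =
     e^-1 * (e * x - y) ^+ 2 by rewrite mulr_ge0 ?sqr_ge0// invr_ge0 ltW.
  by field; rewrite gt_eqF.
by have := key a c; have := key b d; lra.
Qed.

(** The constant comes from induction on the two-term inequality; the error terms
    that it bounds are made small after n is fixed. *)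
Lemma cabs2_sum_le n (F : 'I_n -> R[i]) :
  cabs (\sum_i F i) ^+ 2 <= 2 ^+ n * \sum_i cabs (F i) ^+ 2.
Proof.
elim: n F => [|n IH] F; first by rewrite !big_ord0 cabs20 mulr0.
rewrite !big_ord_recl.
have := @cabs2D_le 1 (F ord0) (\sum_(i < n) F (lift ord0 i)) ltr01.
move=> /le_trans; apply; rewrite invr1 mulrDr lerD//.
  rewrite ler_wpM2r ?sqr_ge0// [2 ^+ n.+1]exprS -[1 + 1]/(2 : R).
  by rewrite ler_peMr// exprn_ege1// ler1n.
by rewrite [2 ^+ n.+1]exprS -mulrA ler_wpM2l//; exact: IH.
Qed.

Lemma expiD s t : expi (s + t) = expi s * expi t.
Proof. by apply/eqP; rewrite eq_complex /= cosD sinD eqxx /= addrC. Qed.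

Lemma expi0 : expi 0 = 1 :> R[i].
Proof. by rewrite /expi cos0 sin0. Qed.

Lemma expiN t : expi (- t) = Num.conj (expi t).
Proof. by rewrite /expi cosN sinN. Qed.

Lemma cabs2_expi t : cabs (expi t) ^+ 2 = 1.
Proof. by rewrite cabs2E /= cos2Dsin2. Qed.

Lemma expiMn t n : expi (t *+ n) = expi t ^+ n.
Proof. by elim: n => [|n IH]; rewrite ?mulr0n ?expi0// mulrS exprS expiD IH. Qed.

Lemma expi_2pi_int (m : int) : expi (2 * pi * m%:~R) = 1 :> R[i].
Proof.
have h n : expi (2 * pi * n%:R) = 1 :> R[i].
  rewrite mulr_natr expiMn mulr_natl /expi cos2pi sin2pi.
  by rewrite -[_ +i* _]/(1 : R[i]) expr1n.
case: (intP m) => [|n|n]; first by rewrite mulr0 expi0.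
- exact: h.
- by rewrite mulrNz mulrN expiN h rmorph1.
Qed.

Lemma expi_pi_odd (m : int) : expi (2 * pi * m%:~R + pi) = -1 :> R[i].
Proof.
rewrite expiD expi_2pi_int mul1r /expi cospi sinpi.
by apply/eqP; rewrite eq_complex /= oppr0 !eqxx.
Qed.

End ComplexModulus.

(** * Orthonormality of the exponentials on Omega *)

Section Orthonormality.
Context {R : realType}.
Local Notation mu := (@lebesgue_measure R).

Lemma measurable_Omega N : measurable (Omega R N).
Proof. by apply: measurableU; exact: measurable_itv. Qed.

Lemma integrable_itvcc (f : R -> R) (a b : R) : continuous f ->
  mu.-integrable `[a, b] (EFin \o f).
Proof.
move=> cf; apply: continuous_compact_integrable; first exact: segment_compact.
exact: continuous_subspaceT.
Qed.

Lemma integrable_Omega N (f : R -> R) : continuous f ->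
  mu.-integrable (Omega R N) (EFin \o f).
Proof.
move=> cf; have := integrable_itvcc 0 ((N%:R + 1) / 2) cf.
apply: integrableS => //; first exact: measurable_Omega.
move=> x [] /=; rewrite !in_itv/= => /andP[x0 x1]; have := ler0n R N; lra.
Qed.

Lemma Rintegral_Omega N (f F : R -> R) : (0 < N)%N -> continuous f ->
  (forall x : R, is_derive x 1 F (f x)) ->
  (\int[mu]_(x in Omega R N) f x =
    F (1 / 2) - F 0 + (F ((N%:R + 1) / 2) - F (N%:R / 2)))%R.
Proof.
move=> N0 cf dF.
have cF : continuous F.
  move=> x; apply: differentiable_continuous.
  by apply/derivable1_diffP; have [] := dF x.
have FTC a b : (a < b)%R -> (\int[mu]_(x in `[a, b[) f x = F b - F a)%R.
  move=> ab; rewrite Rintegral_itv_bndo_bndc; last first.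
    have := integrable_itvcc a b cf; apply: integrableS => //.
    by apply: subset_itvl; rewrite bnd_simp.
  rewrite /Rintegral (@continuous_FTC2 _ f F)//.
  - exact: continuous_subspaceT.
  - split; first by move=> x _; have [] := dF x.
      by apply: cvg_at_right_filter; exact: cF.
    by apply: cvg_at_left_filter; exact: cF.
  - by move=> x _; rewrite derive1E; have [_] := dF x.
have N1 : 1 <= N%:R :> R by rewrite ler1n.
rewrite Rintegral_setU ?measurable_itv//; last 2 first.
- exact: integrable_Omega.
- apply/disj_setPLR => x /=; rewrite !in_itv/= => /andP[_ x1] /andP[x2 _]; lra.
by rewrite !FTC//; lra.
Qed.

Lemma Rintegral_sum N I (s : seq I) (F : I -> R -> R) :
  (forall i, continuous (F i)) ->
  (\int[mu]_(x in Omega R N) (\sum_(i <- s) F i x) =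
   \sum_(i <- s) \int[mu]_(x in Omega R N) F i x)%R.
Proof.
move=> cF; elim: s => [|i s IH].
  under eq_Rintegral do rewrite big_nil.
  by rewrite Rintegral_cst ?mul0r ?big_nil//; exact: measurable_Omega.
under eq_Rintegral do rewrite big_cons.
rewrite big_cons -IH RintegralD//; first exact: measurable_Omega.
- exact: integrable_Omega.
- apply: integrable_Omega => x.
  by apply: cvg_big => [|j _]; [exact: add_continuous|exact: cF].
Qed.

End Orthonormality.

Section Frequencies.
Context {R : realType}.
Local Notation mu := (@lebesgue_measure R).
Variables (N r : nat).
Hypotheses (N0 : (0 < N)%N) (r_odd : odd r).

(** This is where the parity of r enters. Two frequencies in the same class mod 2
    differ by an even integer, so the character of the difference has equal values
    at the ends of each half of Omega. Otherwise the difference times N is odd, and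
    translation by N/2 changes the sign of the character, so the contributions of
    the two halves cancel. *)
Lemma Lambda_sub_expi (l l' : R) : Lambda R N r l -> Lambda R N r l' ->
  expi (2 * pi * (l - l') * (1 / 2)) = 1 :> R[i] \/
  expi (2 * pi * (l - l') * (N%:R / 2)) = -1 :> R[i].
Proof.
have Nn0 : N%:R != 0 :> R by rewrite pnatr_eq0 -lt0n.
have rE : r%:R = 2 * (r./2)%:R + 1 :> R.
  by rewrite -[in LHS](odd_double_half r) r_odd -muln2 natrD natrM addrC mulrC.
move=> [a ha [m _ <-]] [a' ha' [m' _ <-]].
case: ha => ->; case: ha' => ->.
- left; rewrite -[RHS](expi_2pi_int (m - m')); congr expi.
  by rewrite rmorphB /=; field.
- right; rewrite -[RHS](expi_pi_odd (N%:Z * (m - m') - r./2%:Z - 1)); congr expi.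
  by rewrite !rmorphB rmorphM rmorphB /= rE; field.
- right; rewrite -[RHS](expi_pi_odd (N%:Z * (m - m') + r./2%:Z)); congr expi.
  by rewrite rmorphD rmorphM rmorphB /= rE; field.
- left; rewrite -[RHS](expi_2pi_int (m - m')); congr expi.
  by rewrite rmorphB /=; field.
Qed.

Lemma continuous_cosM (k : R) : continuous (fun x : R => cos (k * x)).
Proof.
by move=> x; apply: continuous_comp; [exact: mulrl_continuous|exact: continuous_cos].
Qed.

Lemma continuous_sinM (k : R) : continuous (fun x : R => sin (k * x)).
Proof.
by move=> x; apply: continuous_comp; [exact: mulrl_continuous|exact: continuous_sin].
Qed.

Lemma continuous_Re_expi (c : R[i]) (k : R) :
  continuous (fun x => complex.Re (c * expi (k * x))).
Proof.
case: c => u v /= x; apply: cvgB; apply: cvgMr.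
  exact: continuous_cosM.
exact: continuous_sinM.
Qed.

Lemma is_derive_Re_expi (c : R[i]) (k x : R) :
  is_derive x 1 (fun x => complex.Re (c * expi (k * x)))
    (complex.Re (c * k%:C%C * 'i%C * expi (k * x))).
Proof.
case: c => u v /=.
apply: is_derive_eq; rewrite /GRing.scale /=; ring.
Qed.

Lemma Rintegral_expi (c : R[i]) (l l' : R) :
  Lambda R N r l -> Lambda R N r l' ->
  (\int[mu]_(x in Omega R N) complex.Re (c * expi (2 * pi * (l - l') * x)) =
   if l == l' then complex.Re c else 0)%R.
Proof.
move=> hl hl'; case: eqVneq => [->|ll'].
  under eq_Rintegral do rewrite subrr mulr0 mul0r expi0 mulr1.
  have dF (x : R) : is_derive x 1 (fun x => complex.Re c * x) (complex.Re c).
    by apply: is_derive_eq; rewrite /GRing.scale /=; ring.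
  rewrite (Rintegral_Omega N0 _ dF); last by move=> x; exact: cst_continuous.
  by field.
set k := 2 * pi * (l - l').
have k0 : k != 0 by rewrite !mulf_neq0 ?subr_eq0// gt_eqF// pi_gt0.
pose c' := c / (k%:C%C * 'i%C).
have i0 : 'i%C != 0 :> R[i] by rewrite eq_complex /= oner_eq0 andbF.
have kC0 : k%:C%C != 0 :> R[i] by rewrite eq_complex /= eqxx andbT.
have cE : c = c' * k%:C%C * 'i%C by rewrite -mulrA /c' divfK// mulf_neq0.
have dF (x : R) : is_derive x 1 (fun x => complex.Re (c' * expi (k * x)))
    (complex.Re (c * expi (k * x))).
  by have := is_derive_Re_expi c' k x; rewrite -cE.
rewrite (Rintegral_Omega N0 _ dF); last exact: continuous_Re_expi.
have -> : k * ((N%:R + 1) / 2) = k * (N%:R / 2) + k * (1 / 2) by field.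
rewrite expiD mulr0 expi0.
have ReB (z w : R[i]) : complex.Re (z - w) = complex.Re z - complex.Re w.
  by case: z; case: w.
have ReD (z w : R[i]) : complex.Re (z + w) = complex.Re z + complex.Re w.
  by case: z; case: w.
rewrite -!ReB -ReD; have [E|E] := Lambda_sub_expi hl hl'; rewrite -/k in E; rewrite E.
  by rewrite mulr1 !mulr1 !subrr addr0.
by rewrite (_ : _ + _ = 0)//; ring.
Qed.

Lemma cabs2_trigpolyE (B : seq (Lambda R N r)) (a : Lambda R N r -> R[i]) x :
  cabs (\sum_(l <- B) a l * expi (2 * pi * val l * x)) ^+ 2 =
  \sum_(l <- B) \sum_(l' <- B)
    complex.Re (a l * (a l')^* * expi (2 * pi * (val l - val l') * x)).
Proof.
rewrite cabs2_sumE; apply: eq_bigr => l _; apply: eq_bigr => l' _.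
congr complex.Re; rewrite rmorphM /= -expiN mulrACA -expiD.
by congr (_ * expi _); ring.
Qed.

(** The square expands into characters of the differences of frequencies, and
    only the diagonal terms survive integration. *)
Lemma integral_cabs2_trigpoly (B : seq (Lambda R N r))
    (a : Lambda R N r -> R[i]) : uniq B ->
  (\int[mu]_(x in Omega R N)
     (cabs (\sum_(l <- B) a l * expi (2 * pi * val l * x))%R ^+ 2)%:E =
   (\sum_(l <- B) cabs (a l) ^+ 2)%:E)%E.
Proof.
move=> uB; under eq_integral do rewrite cabs2_trigpolyE.
pose T l l' x := complex.Re (a l * (a l')^* * expi (2 * pi * (val l - val l') * x)).
have cT l : continuous (fun x => \sum_(l' <- B) T l l' x).
  move=> x; apply: cvg_big => [|l' _]; first exact: add_continuous.
  exact: continuous_Re_expi.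
have <- : (\int[mu]_(x in Omega R N) (\sum_(l <- B) \sum_(l' <- B) T l l' x) =
    \sum_(l <- B) cabs (a l) ^+ 2)%R.
  rewrite Rintegral_sum// [RHS]big_seq [LHS]big_seq; apply: eq_bigr => l lB.
  rewrite Rintegral_sum; last by move=> l'; exact: continuous_Re_expi.
  have hL (k : Lambda R N r) : Lambda R N r (val k) by exact: set_mem (valP k).
  under eq_bigr => l' _ do rewrite (Rintegral_expi _ (hL l) (hL l')).
  rewrite (bigD1_seq l)//= eqxx big1 ?addr0; last first.
    move=> l' ll'; case: eqP => // /val_inj /eqP.
    by rewrite eq_sym (negbTE ll').
  by rewrite -cabs2_mulJ.
rewrite /Rintegral fineK//; apply: integrable_fin_num.
  exact: measurable_Omega.
apply: integrable_Omega => x.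
by apply: cvg_big => [|l _]; [exact: add_continuous|exact: cT].
Qed.

End Frequencies.

(** * The synthesis bound *)

Section FiniteSums.
Context {R : realType} {T : choiceType}.
Implicit Types (a : T -> R) (s : seq T).

Lemma sum_le_esum a s : uniq s ->
  ((\sum_(x <- s) a x)%:E <= \esum_(x in [set: T]) (a x)%:E)%E.
Proof.
move=> us; apply: esum_ge; exists [set` s]; first by split => //; exact: finite_seq.
by rewrite -fsbig_seq// sumEFin.
Qed.

Lemma esum_tail a (e : R) : (forall x, 0 <= a x) ->
  (\esum_(x in [set: T]) (a x)%:E < +oo)%E -> 0 < e ->
  exists A : {fset T}, forall s, uniq s -> (forall x, x \in s -> x \notin A) ->
    \sum_(x <- s) a x <= e.
Proof.
move=> a0 afin e0.
have a0' : (0 <= \esum_(x in [set: T]) (a x)%:E)%E.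
  by apply: esum_ge0 => x _; rewrite lee_fin.
have fin : \esum_(x in [set: T]) (a x)%:E \is a fin_num by rewrite ge0_fin_numE.
have [_ [X [finX _] <-] lt] := ub_ereal_sup_adherent e0 fin.
exists (fset_set X) => s us sX.
have := @sum_le_esum a (fset_set X ++ s).
rewrite cat_uniq fset_uniq us andbT /= => /(_ _)/wrap[].
  by apply/hasPn => x /sX.
rewrite big_cat/= => le1; move: lt; rewrite fsbig_finite// sumEFin.
rewrite -/(esum _ _); move: fin le1; case: (esum _ _) => // E _.
by rewrite -EFinB lte_fin lee_fin; lra.
Qed.

Lemma esum_finsupp_lty a (B : {fset T}) : (forall x, 0 <= a x) ->
  (forall x, x \notin B -> a x = 0) ->
  (\esum_(x in [set: T]) (a x)%:E < +oo)%E.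
Proof.
move=> a0 aB.
rewrite (_ : \esum_(x in _) _ = \esum_(x in [set` B]) (a x)%:E).
  rewrite esum_fset//; last by move=> i _; rewrite lee_fin.
  by rewrite -fsbig_seq// sumEFin ltry.
rewrite [RHS]esum_mkcond; apply: eq_esum => x _.
by case: ifPn => //; rewrite notin_setE /= => /negP/aB ->.
Qed.

Lemma partial_sumE (V : zmodType) (f : T -> V) (A : {fset T}) :
  summability.partial_sum f A = \sum_(x <- A) f x.
Proof. by rewrite /summability.partial_sum big_seq_fsetE. Qed.

End FiniteSums.

Section Synthesis.
Context {R : realType}.
Variables (N r n : nat).
Local Notation L := (Lambda R N r).
Implicit Types (f g : L -> 'M[R[i]]_n) (B : {fset L}).

Definition mxnorm2 (M : 'M[R[i]]_n) : R := \sum_m \sum_k cabs (M m k) ^+ 2.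

Lemma mxnorm2_ge0 M : 0 <= mxnorm2 M.
Proof. by apply: sumr_ge0 => m _; apply: sumr_ge0 => k _; exact: sqr_ge0. Qed.

Lemma mxnorm20 : mxnorm2 0 = 0.
Proof. by apply: big1 => m _; apply: big1 => k _; rewrite mxE cabs20. Qed.

(** The net of partial sums is eventually constant. *)
Lemma ell2_inner_finsupp f g B : (forall l, l \notin B -> f l = 0) ->
  ell2_inner f g = \sum_(l <- B) \sum_m \sum_k f l m k * (g l m k)^*.
Proof.
move=> fB; rewrite /ell2_inner /summability.sum.
apply: (@cvg_lim R[i]^o (@norm_hausdorff R[i] R[i]^o) _ _ summability.totally_filter).
apply: (@cvg_near_cst _ _ _ _ _ summability.totally_filter).
exists B => // A /= BA; rewrite partial_sumE.
rewrite [RHS](big_fset_incl _ BA)// => l _ /fB fl0.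
by apply: big1 => m _; apply: big1 => k _; rewrite fl0 mxE mul0r.
Qed.

Lemma ell2_finsupp f B : (forall l, l \notin B -> f l = 0) -> ell2 f.
Proof.
move=> fB; apply: (@esum_finsupp_lty _ _ (fun l => mxnorm2 (f l)) B).
  by move=> l; exact: mxnorm2_ge0.
by move=> l /fB ->; exact: mxnorm20.
Qed.

Lemma ell2_norm_finsupp f B : (forall l, l \notin B -> f l = 0) ->
  ell2_norm f ^+ 2 = \sum_(l <- B) mxnorm2 (f l).
Proof.
move=> fB; rewrite /ell2_norm (ell2_inner_finsupp _ fB).
have -> : complex.Re (\sum_(l <- B) \sum_m \sum_k f l m k * (f l m k)^*) =
    \sum_(l <- B) mxnorm2 (f l).
  rewrite Re_sum; apply: eq_bigr => l _; rewrite Re_sum; apply: eq_bigr => m _.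
  by rewrite Re_sum; apply: eq_bigr => k _; rewrite -cabs2_mulJ.
by rewrite sqr_sqrtr//; apply: sumr_ge0 => l _; exact: mxnorm2_ge0.
Qed.

(** The index map underlying the displacement operator. *)
Definition displace (l l' : L) : L :=
  exist _ (val l' - 2 * N%:R * val l)
    (mem_set (Lambda_shift (set_mem (valP l)) (set_mem (valP l')))).

Definition synthesize Q (c : 'I_Q -> R[i]) (l : 'I_Q -> L) f (l' : L) : 'M[R[i]]_n :=
  \matrix_(m, k) \sum_q c q * f (displace (l q) l') m k.

(** Testing the Bessel inequality on the restriction of the combination to the
    finite set B gives S <= sum Re (conj c_q z_q), where S is the sum to be
    bounded and the z_q are Bessel coefficients with sum |z_q|^2 <= b0 S. Young's
    inequality with weight b0 then absorbs half of S in the left-hand side. *)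
Lemma synthesis_bound p (fs : 'I_p -> L -> 'M[R[i]]_n) (b0 : R) (j : 'I_p)
    Q (c : 'I_Q -> R[i]) (l : 'I_Q -> L) B :
  is_bessel_sequence fs b0 -> injective l ->
  \sum_(l' <- B) mxnorm2 (synthesize c l (fs j) l') <= b0 * \sum_q cabs (c q) ^+ 2.
Proof.
move=> [b0_gt0 bessel] linj.
pose f l' := if l' \in B then synthesize c l (fs j) l' else 0.
have fB l' : l' \notin B -> f l' = 0 by rewrite /f => /negbTE ->.
pose z q := ell2_inner f (displacement (l q) (fs j)).
set S := (X in X <= _).
have SE : ell2_norm f ^+ 2 = S.
  rewrite (ell2_norm_finsupp fB) /S [LHS]big_seq [RHS]big_seq.
  by apply: eq_bigr => l' l'B; rewrite /f l'B.
have zS : \sum_q cabs (z q) ^+ 2 <= b0 * S.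
  rewrite -lee_fin -SE; apply: le_trans (bessel _ (ell2_finsupp fB)).
  rewrite (bigD1 j)//=; apply: (@le_trans _ _
    (\esum_(l0 in [set: L])
      (cabs (ell2_inner f (displacement l0 (fs j))) ^+ 2)%:E)%E).
    have := @sum_le_esum _ _
      (fun l0 => cabs (ell2_inner f (displacement l0 (fs j))) ^+ 2)
      [seq l q | q <- index_enum 'I_Q].
    by rewrite big_map; apply; rewrite map_inj_uniq ?index_enum_uniq.
  rewrite leeDl//; apply: sume_ge0 => i _; apply: esum_ge0 => l0 _.
  by rewrite lee_fin sqr_ge0.
have zE : S = \sum_q complex.Re ((c q)^* * z q).
  rewrite -Re_sum.
  have -> : \sum_q (c q)^* * z q = \sum_(l' <- B) \sum_m \sum_k
      synthesize c l (fs j) l' m k * (synthesize c l (fs j) l' m k)^*.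
    under eq_bigr do rewrite /z (ell2_inner_finsupp _ fB) mulr_sumr.
    rewrite exchange_big/= [LHS]big_seq [RHS]big_seq; apply: eq_bigr => l' l'B.
    under eq_bigr do rewrite mulr_sumr.
    rewrite exchange_big/=; apply: eq_bigr => m _.
    under eq_bigr do rewrite mulr_sumr.
    rewrite exchange_big/=; apply: eq_bigr => k _.
    rewrite [X in _ = _ * X](_ : _ =
      \sum_q (c q)^* * (fs j (displace (l q) l') m k)^*); last first.
      rewrite /synthesize mxE rmorph_sum.
      by apply: eq_bigr => q _; rewrite rmorphM.
    by rewrite mulr_sumr; apply: eq_bigr => q _; rewrite /f l'B mulrCA.
  rewrite Re_sum; apply: eq_bigr => l' _; rewrite Re_sum; apply: eq_bigr => m _.
  by rewrite Re_sum; apply: eq_bigr => k _; rewrite -cabs2_mulJ.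
have young (u v : R[i]) :
    2 * complex.Re (u^* * v) <= b0 * cabs u ^+ 2 + b0^-1 * cabs v ^+ 2.
  rewrite !cabs2E; case: u v => a b [c' d] /=.
  have key x y : 2 * (x * y) <= b0 * x ^+ 2 + b0^-1 * y ^+ 2.
    rewrite -subr_ge0.
    suff -> : b0 * x ^+ 2 + b0^-1 * y ^+ 2 - 2 * (x * y) =
        b0^-1 * (b0 * x - y) ^+ 2.
      by rewrite mulr_ge0 ?sqr_ge0// invr_ge0 ltW.
    by field; rewrite gt_eqF.
  by have := key a c'; have := key b d; lra.
have : 2 * S <= b0 * \sum_q cabs (c q) ^+ 2 + b0^-1 * \sum_q cabs (z q) ^+ 2.
  rewrite zE !mulr_sumr -big_split/=; apply: ler_sum => q _; exact: young.
have : b0^-1 * \sum_q cabs (z q) ^+ 2 <= S.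
  by rewrite ler_pdivrMl.
lra.
Qed.

End Synthesis.

(** * Modulating a Fourier transform *)

Section ComplexMeasurable.
Context {R : realType}.
Implicit Types (D : set R) (F G : R -> R[i]).

Definition cmeasurable D F :=
  measurable_fun D (fun x => complex.Re (F x)) /\
  measurable_fun D (fun x => complex.Im (F x)).

Lemma cmeasurableD D F G : cmeasurable D F -> cmeasurable D G ->
  cmeasurable D (fun x => F x + G x).
Proof.
move=> [F1 F2] [G1 G2]; split.
  rewrite (_ : (fun x => _) = (fun x => complex.Re (F x) + complex.Re (G x))).
    exact: measurable_funD.
  by apply/funext => x; case: (F x); case: (G x).
rewrite (_ : (fun x => _) = (fun x => complex.Im (F x) + complex.Im (G x))).
  exact: measurable_funD.
by apply/funext => x; case: (F x); case: (G x).
Qed.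

Lemma cmeasurableM D F G : cmeasurable D F -> cmeasurable D G ->
  cmeasurable D (fun x => F x * G x).
Proof.
move=> [F1 F2] [G1 G2]; split.
  rewrite (_ : (fun x => _) = (fun x => complex.Re (F x) * complex.Re (G x) -
    complex.Im (F x) * complex.Im (G x))).
    by apply: measurable_funB; exact: measurable_funM.
  by apply/funext => x; case: (F x); case: (G x).
rewrite (_ : (fun x => _) = (fun x => complex.Re (F x) * complex.Im (G x) +
  complex.Im (F x) * complex.Re (G x))).
  by apply: measurable_funD; exact: measurable_funM.
by apply/funext => x; case: (F x); case: (G x).
Qed.

Lemma cmeasurable_cst D z : cmeasurable D (fun=> z).
Proof. by split; exact: measurable_cst. Qed.

Lemma cmeasurableN D F : cmeasurable D F -> cmeasurable D (fun x => - F x).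
Proof.
move=> mF; rewrite (_ : (fun x => _) = (fun x => -1 * F x)).
  exact: cmeasurableM (cmeasurable_cst _ _) mF.
by apply/funext => x; rewrite mulN1r.
Qed.

Lemma cmeasurable_sum D I (s : seq I) (F : I -> R -> R[i]) :
  (forall i, cmeasurable D (F i)) -> cmeasurable D (fun x => \sum_(i <- s) F i x).
Proof.
move=> mF; elim: s => [|i s IH].
  rewrite (_ : (fun x => _) = fun=> 0); first exact: cmeasurable_cst.
  by apply/funext => x; rewrite big_nil.
rewrite (_ : (fun x => _) = fun x => F i x + \sum_(i <- s) F i x).
  exact: cmeasurableD.
by apply/funext => x; rewrite big_cons.
Qed.

Lemma cmeasurable_expi D (k : R) : cmeasurable D (fun x => expi (k * x)).
Proof.
by split; apply: measurable_funS (continuous_measurable_fun _) => //;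
  [exact: continuous_cosM|exact: continuous_sinM].
Qed.

Lemma cmeasurable_trigpoly D I (s : seq I) (a : I -> R[i]) (k : I -> R) :
  cmeasurable D (fun x => \sum_(i <- s) a i * expi (k i * x)).
Proof.
apply: cmeasurable_sum => i.
by apply: cmeasurableM; [exact: cmeasurable_cst|exact: cmeasurable_expi].
Qed.

Lemma measurable_cabs2 D F : cmeasurable D F ->
  measurable_fun D (fun x => cabs (F x) ^+ 2).
Proof.
move=> [F1 F2]; rewrite (_ : (fun x => _) =
  (fun x => complex.Re (F x) ^+ 2 + complex.Im (F x) ^+ 2)).
  by apply: measurable_funD; exact: measurable_funX.
by apply/funext => x; rewrite cabs2E.
Qed.

End ComplexMeasurable.

Section Modulation.
Context {R : realType}.
Local Notation mu := (@lebesgue_measure R).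
Variables (N r : nat).
Hypotheses (N0 : (0 < N)%N) (r_odd : odd r).
Local Notation L := (Lambda R N r).

Lemma even_Lambda (m : int) : 2 * m%:~R \in Lambda R N r.
Proof. by apply/mem_set; exists 0; [left|exists m; rewrite ?add0r]. Qed.

Definition even_freq (m : int) : L := exist (fun x => x \in L) _ (even_Lambda m).

Lemma even_freq_inj : injective even_freq.
Proof.
by move=> m m' /(congr1 val)/= /mulfI/intr_inj; apply; rewrite pnatr_eq0.
Qed.

Lemma displaceK (m : int) : cancel (displace (even_freq (- m))) (displace (even_freq m)).
Proof.
by move=> l; apply: val_inj; rewrite /= rmorphN /=; ring.
Qed.

Lemma displace_inj (l : L) : injective (displace l).
Proof. by move=> l1 l2 /(congr1 val)/= /addIr /val_inj. Qed.

Variables (Q : nat) (c : 'I_Q -> R[i]).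
Hypothesis c1 : forall q, cabs (c q) ^+ 2 = 1.

Definition modulator (x : R) : R[i] :=
  \sum_q c q * expi (2 * pi * (2 * N%:R * val (even_freq q)) * x).

Lemma cabs2_modulator_le x : cabs (modulator x) ^+ 2 <= 2 ^+ Q * Q%:R.
Proof.
apply: le_trans (cabs2_sum_le _) _; rewrite ler_wpM2l ?exprn_ge0//.
under eq_bigr do rewrite cabs2M c1 cabs2_expi mulr1.
by rewrite sumr_const card_ord.
Qed.

(** The spectrum of the product of the modulator with a trigonometric polynomial
    of spectrum A. *)
Definition spread (A : {fset L}) : {fset L} :=
  [fset displace (even_freq (- (nat_of_ord q)%:Z)) l | q in 'I_Q, l in A]%fset.

Lemma modulate_trigpoly (A : {fset L}) (h : L -> R[i]) x :
  modulator x * (\sum_(l <- A) h l * expi (2 * pi * val l * x)) =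
  \sum_(l <- spread A)
    (\sum_(q < Q | displace (even_freq q) l \in A)
        c q * h (displace (even_freq q) l)) * expi (2 * pi * val l * x).
Proof.
rewrite /modulator mulr_suml.
under [RHS]eq_bigr do rewrite mulr_suml big_mkcond/=.
rewrite exchange_big/=; apply: eq_bigr => q _.
rewrite -big_mkcond/= -[RHS]big_filter.
have pA : perm_eq A [seq displace (even_freq q) l | l <- spread A &
    displace (even_freq q) l \in A].
  apply: uniq_perm; first exact: fset_uniq.
    by rewrite map_inj_uniq ?filter_uniq ?fset_uniq//; exact: displace_inj.
  move=> l; apply/idP/mapP => [lA|[l' + ->]]; last by rewrite mem_filter => /andP[].
  exists (displace (even_freq (- (nat_of_ord q)%:Z)) l); last by rewrite displaceK.
  rewrite mem_filter displaceK lA /=; apply/imfset2P.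
  by exists q => //; exists l.
rewrite (perm_big _ pA)/= big_map mulr_sumr; apply: eq_bigr => l _.
rewrite mulrACA -expiD; congr (_ * expi _) => /=; ring.
Qed.

(** G, the trigonometric polynomial with the coefficients of the whole
    combination on the set [spread A], is compared with the product of the
    modulator P and F. With T the partial sum of F over A, the difference P F - G
    is P (F - T), small because F - T is, minus the part of G coming from
    coefficients of h outside A, small by hypothesis on the tails of h. *)
Lemma modulated_integral_le (F : R -> R[i]) (h : L -> R[i]) (A : {fset L}) (e d : R) :
  0 < e -> 0 <= d ->
  sq_integrable N F ->
  (\int[mu]_(x in Omega R N)
     (cabs (F x - \sum_(l <- A) h l * expi (2 * pi * val l * x))%R ^+ 2)%:E <= d%:E)%E ->
  (forall s, uniq s -> (forall l, l \in s -> l \notin A) ->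
     \sum_(l <- s) cabs (h l) ^+ 2 <= d) ->
  (\int[mu]_(x in Omega R N) (cabs (modulator x * F x)%R ^+ 2)%:E <=
   ((1 + e) * (\sum_(l <- spread A)
       cabs (\sum_q c q * h (displace (even_freq q) l)) ^+ 2) +
    (1 + e^-1) * (4 * (2 ^+ Q * Q%:R) * d))%:E)%E.
Proof.
move=> e0 d0 [mF1 mF2 _] intd tail.
have mF : cmeasurable (Omega R N) F by [].
pose T x := \sum_(l <- A) h l * expi (2 * pi * val l * x).
have mT : cmeasurable (Omega R N) T by exact: cmeasurable_trigpoly.
pose g l := \sum_q c q * h (displace (even_freq q) l).
pose gA l := \sum_(q < Q | displace (even_freq q) l \in A)
        c q * h (displace (even_freq q) l).
pose gN l := \sum_(q < Q | displace (even_freq q) l \notin A)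
        c q * h (displace (even_freq q) l).
pose G a x := \sum_(l <- spread A) a l * expi (2 * pi * val l * x).
have mG a : cmeasurable (Omega R N) (G a) by exact: cmeasurable_trigpoly.
have GE x : G g x = modulator x * T x + G gN x.
  rewrite modulate_trigpoly -big_split/=; apply: eq_bigr => l _.
  rewrite -mulrDl.
  by rewrite [g l](bigID (fun q : 'I_Q => displace (even_freq q) l \in A)).
have gN_le : \sum_(l <- spread A) cabs (gN l) ^+ 2 <= 2 ^+ Q * Q%:R * d.
  have -> : 2 ^+ Q * Q%:R * d = \sum_(q < Q) 2 ^+ Q * d.
    by rewrite sumr_const card_ord -mulrA [Q%:R * d]mulrC mulrA mulr_natr.
  apply: (@le_trans _ _ (\sum_(l <- spread A) 2 ^+ Q * \sum_(q < Q)
    if displace (even_freq q) l \notin A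
    then cabs (h (displace (even_freq q) l)) ^+ 2 else 0)).
    apply: ler_sum => l _; rewrite /gN big_mkcond/=.
    apply: le_trans (cabs2_sum_le _) _; rewrite ler_wpM2l ?exprn_ge0//.
    apply: ler_sum => q _; case: ifPn; first by rewrite cabs2M c1 mul1r.
    by rewrite cabs20.
  rewrite -mulr_sumr -mulr_sumr ler_wpM2l ?exprn_ge0// exchange_big/=.
  apply: ler_sum => q _; rewrite -big_mkcond/= -big_filter.
  have := tail [seq displace (even_freq q) l | l <- spread A &
    displace (even_freq q) l \notin A].
  rewrite big_map; apply.
    by rewrite map_inj_uniq ?filter_uniq ?fset_uniq//; exact: displace_inj.
  by move=> l /mapP[l' + ->]; rewrite mem_filter => /andP[].
have mP : cmeasurable (Omega R N) modulator by exact: cmeasurable_trigpoly.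
have mFT : cmeasurable (Omega R N) (fun x => F x - T x).
  by apply: cmeasurableD => //; exact: cmeasurableN.
set K := 2 ^+ Q * Q%:R in gN_le *.
have K0 : 0 <= K by rewrite mulr_ge0// exprn_ge0.
have pw x : cabs (modulator x * F x) ^+ 2 <= (1 + e) * cabs (G g x) ^+ 2 +
   ((1 + e^-1) * (2 * K) * cabs (F x - T x) ^+ 2 +
    (1 + e^-1) * 2 * cabs (G gN x) ^+ 2).
  have -> : modulator x * F x =
      G g x + (modulator x * (F x - T x) + (- 1) * G gN x).
    by rewrite GE; ring.
  apply: le_trans (cabs2D_le _ _ e0) _; rewrite lerD2l.
  rewrite -!(mulrA (1 + e^-1)) -mulrDr ler_wpM2l ?addr_ge0 ?invr_ge0 ?(ltW e0)//.
  apply: le_trans (cabs2D_le _ _ ltr01) _; rewrite invr1 -[1 + 1]/(2 : R) lerD//.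
    rewrite cabs2M -[leRHS]mulrA ler_wpM2l// ler_wpM2r ?sqr_ge0//.
    exact: cabs2_modulator_le.
  rewrite cabs2M (_ : cabs (-1) ^+ 2 = 1) ?mul1r//.
  by rewrite cabs2E /= sqrrN expr1n oppr0 expr0n addr0.
have mO := @measurable_Omega R N.
have mE (H : R -> R[i]) (k : R) : cmeasurable (Omega R N) H ->
    measurable_fun (Omega R N) (fun x => (k * cabs (H x) ^+ 2)%:E).
  move=> mH; apply/measurable_EFinP; apply: measurable_funM => //.
  exact: measurable_cabs2.
have pos1 : 0 <= 1 + e by rewrite addr_ge0// ltW.
have pos2 : 0 <= 1 + e^-1 by rewrite addr_ge0// invr_ge0 ltW.
have intZ (H : R -> R[i]) (k : R) : 0 <= k -> cmeasurable (Omega R N) H ->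
   (\int[mu]_(x in Omega R N) (k * cabs (H x) ^+ 2)%:E =
     k%:E * \int[mu]_(x in Omega R N) (cabs (H x) ^+ 2)%:E)%E.
  move=> k0 mH; under eq_integral do rewrite EFinM.
  rewrite ge0_integralZl//.
  - by apply/measurable_EFinP; exact: measurable_cabs2.
  - by move=> x _; rewrite lee_fin sqr_ge0.
have nn (k : R) (z : R[i]) : 0 <= k -> (0 <= (k * cabs z ^+ 2)%:E)%E.
  by move=> k0; rewrite lee_fin mulr_ge0// sqr_ge0.
have k1 : 0 <= (1 + e^-1) * (2 * K) by rewrite !mulr_ge0.
have k2 : 0 <= (1 + e^-1) * 2 by rewrite mulr_ge0.
apply: (@le_trans _ _ (\int[mu]_(x in Omega R N)
  (((1 + e) * cabs (G g x) ^+ 2)%:E +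
   (((1 + e^-1) * (2 * K) * cabs (F x - T x)%R ^+ 2)%:E +
    ((1 + e^-1) * 2 * cabs (G gN x) ^+ 2)%:E)))%E).
  apply: ge0_le_integral => //.
  - by move=> x _; rewrite lee_fin sqr_ge0.
  - by apply/measurable_EFinP; apply: measurable_cabs2; exact: cmeasurableM.
  - by apply: emeasurable_funD; [|apply: emeasurable_funD]; exact: mE.
  - by move=> x _; rewrite -!EFinD lee_fin.
rewrite ge0_integralD//; last 4 first.
- by move=> x _; exact: nn.
- exact: mE.
- by move=> x _; apply: adde_ge0; exact: nn.
- by apply: emeasurable_funD; exact: mE.
rewrite ge0_integralD//; last 4 first.
- by move=> x _; exact: nn.
- exact: mE.
- by move=> x _; exact: nn.
- exact: mE.
rewrite !intZ// ?mulr_ge0//.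
rewrite !(integral_cabs2_trigpoly N0 r_odd) ?fset_uniq//.
rewrite -!EFinM EFinD leeD2l//.
apply: (@le_trans _ _ (((1 + e^-1) * (2 * K))%:E * d%:E + ((1 + e^-1) * 2 * (K * d))%:E)%E).
  apply: leeD; last by rewrite lee_fin ler_wpM2l// mulr_ge0.
  by apply: lee_wpmul2l => //; rewrite lee_fin !mulr_ge0.
by rewrite -EFinM -EFinD lee_fin; lra.
Qed.

End Modulation.

Section ModulatedEnergy.
Context {R : realType}.
Local Notation mu := (@lebesgue_measure R).
Variables (N r n : nat).
Hypotheses (N0 : (0 < N)%N) (r_odd : odd r).
Local Notation L := (Lambda R N r).

Lemma cabs2_entry_le (M : 'M[R[i]]_n) m k : cabs (M m k) ^+ 2 <= mxnorm2 M.
Proof.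
rewrite /mxnorm2 (bigD1 m)//= (bigD1 k)//= -addrA lerDl addr_ge0//.
  by apply: sumr_ge0 => ? _; exact: sqr_ge0.
by apply: sumr_ge0 => ? _; apply: sumr_ge0 => ? _; exact: sqr_ge0.
Qed.

(** One finite set serves all entries at once, both for the convergence in L^2
    and for the tails. *)
Lemma fourier_truncation (f : L -> 'M[R[i]]_n) F d : 0 < d ->
  ell2 f -> is_fourier_transform f F ->
  exists A : {fset L},
    (forall m k, (\int[mu]_(x in Omega R N)
      (cabs (F x m k - \sum_(l <- A) f l m k * expi (2 * pi * val l * x))%R
         ^+ 2)%:E <= d%:E)%E) /\
    (forall m k s, uniq s -> (forall l, l \in s -> l \notin A) ->
       \sum_(l <- s) cabs (f l m k) ^+ 2 <= d).
Proof.
move=> d0 f2 fF.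
have [A0 tail] := esum_tail (fun l => mxnorm2_ge0 (f l)) f2 d0.
pose close (m k : 'I_n) := [set A : {fset L} | (\int[mu]_(x in Omega R N)
      (cabs (F x m k - \sum_(l <- A) f l m k * expi (2 * pi * val l * x))%R
         ^+ 2)%:E < d%:E)%E].
have tot := @summability.totally_filter L.
have near_close m k : summability.totally (close m k).
  have [_ cv] := fF m k.
  have := cv [set y | y < d%:E]%E (open_ereal_lt' _); rewrite lte_fin => /(_ d0).
  rewrite /nbhs /= /fmap /=; congr summability.totally.
  apply/funext => A; rewrite /close /=; congr (is_true (_ < _)%E).
  by apply: eq_integral => x _; rewrite partial_sumE.
have near_A0 : summability.totally [set A | (A0 `<=` A)%fset] by exists A0.
have near_all : summability.totally [set A | forall m k, close m k A].
  apply: (@filter_forall _ _ (fun m A => forall k, close m k A) _ tot) => m.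
  by apply: (@filter_forall _ _ (close m) _ tot) => k; exact: near_close.
have [A [A0A closeA]] := @filter_ex _ _ tot _ (@filterI _ _ tot _ _ near_A0 near_all).
exists A; split=> [m k|m k s us sA]; first exact/ltW/closeA.
apply: (le_trans _ (tail s us _)).
  by apply: ler_sum => l _; exact: cabs2_entry_le.
by move=> l /sA; apply: contra; exact/fsubsetP.
Qed.

Lemma modulated_energy_le p (fs : 'I_p -> L -> 'M[R[i]]_n) (b0 : R) (j : 'I_p)
    (F : R -> 'M[R[i]]_n) Q (c : 'I_Q -> R[i]) :
  is_bessel_sequence fs b0 -> ell2 (fs j) -> is_fourier_transform (fs j) F ->
  (forall q, cabs (c q) ^+ 2 = 1) ->
  (\int[mu]_(x in Omega R N) (cabs (modulator N r c x) ^+ 2 * mxnorm2 (F x))%:E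
   <= (b0 * Q%:R)%:E)%E.
Proof.
move=> bessel f2 fF c1.
have b00 : 0 < b0 := bessel.1.
have mF m k : cmeasurable (Omega R N) (fun x => F x m k) by have [[]] := fF m k.
have mP : cmeasurable (Omega R N) (modulator N r c).
  exact: cmeasurable_trigpoly.
have mO := @measurable_Omega R N.
apply/lee_addgt0Pr => t t0; rewrite -EFinD.
set M := b0 * Q%:R.
have M0 : 0 <= M by rewrite mulr_ge0// ltW.
pose e := t / (2 * (M + 1)).
have e0 : 0 < e by rewrite divr_gt0// mulr_gt0// ltr_wpDl.
(* e and d are chosen so that each of the two error terms is at most t / 2. *)
have eM : e * M <= t / 2.
  rewrite /e -mulrA invfM -mulrA ler_pM2l// ler_piMr ?invr_ge0//.
  by rewrite mulrC ler_pdivrMr ?mul1r ?lerDl// ltr_wpDl.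
pose K := \sum_(m < n) \sum_(k < n) ((1 + e^-1) * (4 * (2 ^+ Q * Q%:R))).
have K0 : 0 <= K.
  apply: sumr_ge0 => m _; apply: sumr_ge0 => k _.
  by rewrite !mulr_ge0 ?exprn_ge0// addr_ge0// invr_ge0 ltW.
pose d := t / (2 * (K + 1)).
have d0 : 0 < d by rewrite divr_gt0// mulr_gt0// ltr_wpDl.
have dK : K * d <= t / 2.
  rewrite mulrC /d -mulrA invfM -mulrA ler_pM2l// ler_piMr ?invr_ge0//.
  by rewrite mulrC ler_pdivrMr ?mul1r ?lerDl// ltr_wpDl.
have [A [closeA tailA]] := fourier_truncation d0 f2 fF.
under eq_integral do rewrite /mxnorm2 mulr_sumr -sumEFin.
rewrite ge0_integral_sum//; last 2 first.
- move=> m; apply/measurable_EFinP.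
  apply: measurable_funM; first exact: measurable_cabs2.
  by apply: measurable_sum => k; apply: measurable_cabs2; exact: mF.
- move=> m x _; rewrite lee_fin mulr_ge0 ?sqr_ge0// sumr_ge0// => k _.
  exact: sqr_ge0.
apply: (@le_trans _ _ (\sum_m \sum_k
   ((1 + e) * (\sum_(l <- spread Q A)
       cabs (\sum_q c q * fs j (displace (even_freq N r q) l) m k)%R ^+ 2)%R +
    (1 + e^-1) * (4 * (2 ^+ Q * Q%:R)) * d)%:E)%E).
  apply: lee_sum => m _.
  under eq_integral do rewrite mulr_sumr -sumEFin.
  rewrite ge0_integral_sum//; last 2 first.
  - move=> k; apply/measurable_EFinP; apply: measurable_funM; exact: measurable_cabs2.
  - by move=> k x _; rewrite lee_fin mulr_ge0 ?sqr_ge0.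
  apply: lee_sum => k _.
  under eq_integral do rewrite -cabs2M.
  rewrite -(mulrA (1 + e^-1)); apply: (modulated_integral_le N0 r_odd c1
    (F := fun x => F x m k) (h := fun l => fs j l m k)) => //; first exact: ltW.
    exact: (fF m k).1.
  exact: tailA.
under eq_bigr do rewrite sumEFin.
rewrite sumEFin lee_fin.
under eq_bigr do rewrite big_split/= -mulr_sumr -mulr_suml.
rewrite big_split/= -mulr_sumr -mulr_suml -/K.
have -> : \sum_m \sum_k \sum_(l <- spread Q A)
       cabs (\sum_q c q * fs j (displace (even_freq N r q) l) m k) ^+ 2 =
  \sum_(l <- spread Q A) mxnorm2 (synthesize c (fun q => even_freq N r q) (fs j) l).
  rewrite [RHS]exchange_big/=; apply: eq_bigr => m _; rewrite [RHS]exchange_big/=.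
  by apply: eq_bigr => k _; apply: eq_bigr => l _; rewrite mxE.
have := @synthesis_bound R N r n p fs b0 j Q c
  (fun q => even_freq N r q) (spread Q A) bessel.
have -> : \sum_q cabs (c q) ^+ 2 = Q%:R.
  by under eq_bigr do rewrite c1; rewrite sumr_const card_ord.
rewrite -/M => /(_ _)/wrap[].
  by move=> q q' /even_freq_inj [] /ord_inj.
set S := \sum_(l <- _) _ => SM.
have : (1 + e) * S <= (1 + e) * M by rewrite ler_wpM2l// addr_ge0// ltW.
by rewrite mulrDl mul1r; lra.
Qed.

End ModulatedEnergy.

(** * The Dirichlet kernel *)

Section DirichletKernel.
Context {R : realType}.
Implicit Types (u v t d : R) (Q : nat).


Definition dirichlet Q (v : R) : R[i] := \sum_(m < Q) expi (2 * pi * m%:R * v).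

Lemma expiX v Q : expi (v * Q%:R) = expi v ^+ Q.
Proof. by rewrite mulr_natr expiMn. Qed.

Lemma cabs2_expiB1 v : cabs (expi (2 * pi * v) - 1) ^+ 2 = 4 * sin (pi * v) ^+ 2.
Proof.
rewrite cabs2E /= oppr0 addr0.
have -> : 2 * pi * v = (pi * v) *+ 2 by rewrite -mulr_natl; ring.
rewrite cos_mulr2n sin_mulr2n !mulr2n.
have := cos2Dsin2 (pi * v); set c := cos _; set s := sin _ => cs.
have -> : (c * s + c * s) ^+ 2 = 4 * c ^+ 2 * s ^+ 2 by ring.
have -> : c ^+ 2 = 1 - s ^+ 2 by rewrite -cs addrK.
ring.
Qed.

Lemma expi_neq1 v : 0 < `|v| < 1 -> expi (2 * pi * v) != 1 :> R[i].
Proof.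
move=> v01; apply/eqP => E1.
have /eqP := cabs2_expiB1 v; rewrite E1 subrr cabs20 eq_sym mulf_eq0 pnatr_eq0/=.
rewrite sqrf_eq0 => /eqP s0.
have : 0 < sin (pi * `|v|).
  have [v0 v1] := andP v01.
  by apply: sin_gt0_pi; rewrite mulr_gt0 ?pi_gt0//= gtr_pMr// pi_gt0.
case: (ger0P v) => _; rewrite ?mulrN ?sinN s0 ?oppr0 ltxx//.
Qed.

Lemma sum_expi_root Q (k : R) : (0 < Q)%N ->
  expi (2 * pi * k) = 1 :> R[i] -> expi (2 * pi * (k / Q%:R)) != 1 :> R[i] ->
  \sum_(q < Q) expi (2 * pi * (k / Q%:R) * q%:R) = 0 :> R[i].
Proof.
move=> Q0 k1 w1.
have := subrXX (expi (2 * pi * (k / Q%:R))) (1 : R[i]) Q.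
rewrite -expiX expr1n.
rewrite (_ : 2 * pi * (k / Q%:R) * Q%:R = 2 * pi * k); last first.
  by field; rewrite pnatr_eq0 -lt0n.
rewrite k1 subrr => /esym/eqP; rewrite mulf_eq0 subr_eq0 (negbTE w1)/= => /eqP E.
rewrite (reindex_inj rev_ord_inj)/= -[RHS]E; apply: eq_bigr => q _.
by rewrite -subn1 -subnDA add1n expr1n mulr1 -expiX.
Qed.

(** The squared kernel expands into characters of frequency m - m', whose sums
    over the points q/Q are geometric sums of Q-th roots of unity and vanish unless
    m = m'. *)
Lemma dirichlet_partition Q v : (0 < Q)%N ->
  \sum_(q < Q) cabs (dirichlet Q (v - q%:R / Q%:R)) ^+ 2 = Q%:R ^+ 2.
Proof.
move=> Q0; have Qn0 : Q%:R != 0 :> R by rewrite pnatr_eq0 -lt0n.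
pose T (m m' q : 'I_Q) := complex.Re (expi (2 * pi * m%:R * (v - q%:R / Q%:R)) *
  (expi (2 * pi * m'%:R * (v - q%:R / Q%:R)))^*).
transitivity (\sum_q \sum_m \sum_m' T m m' q).
  by apply: eq_bigr => q _; rewrite cabs2_sumE.
rewrite exchange_big/=.
transitivity (\sum_(m < Q) Q%:R : R); last by rewrite sumr_const card_ord expr2 mulr_natr.
apply: eq_bigr => m _; rewrite exchange_big/= (bigD1 m)//= [X in _ + X]big1.
  rewrite addr0 (eq_bigr (fun=> 1)) ?sumr_const ?card_ord// => q _.
  by rewrite /T -cabs2_mulJ cabs2_expi.
move=> m' m'm; rewrite -Re_sum.
pose D : R := m%:R - m'%:R.
under eq_bigr => q _.
  rewrite -expiN -expiD.
  have -> : 2 * pi * m%:R * (v - q%:R / Q%:R) +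
      - (2 * pi * m'%:R * (v - q%:R / Q%:R)) =
    2 * pi * D * v + 2 * pi * (- D / Q%:R) * q%:R by rewrite /D; ring.
  rewrite expiD; over.
rewrite -mulr_sumr (sum_expi_root (k := - D))//.
- by rewrite mulr0.
- rewrite (_ : - D = (m'%:Z - m%:Z)%:~R) ?expi_2pi_int//.
  by rewrite rmorphB /= opprB.
- apply: expi_neq1; rewrite normrM normrN normfV (ger0_norm (ler0n R Q)).
  rewrite divr_gt0 ?ltr0n// ?normr_gt0 ?subr_eq0 ?eqr_nat 1?eq_sym//=.
  rewrite ltr_pdivrMr ?ltr0n// mul1r ltr_norml /D.
  have : m%:R < Q%:R :> R by rewrite ltr_nat.
  have : m'%:R < Q%:R :> R by rewrite ltr_nat.
  have := ler0n R m; have := ler0n R m'; lra.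
Qed.

(** The geometric sum is (e(Qv) - 1) / (e(v) - 1) with e(v) = exp(2 pi i v), and
    |e(v) - 1| = 2 |sin (pi v)|. *)
Lemma dirichlet_tail Q d v : 0 < d < 1 -> d <= v <= 1 - d ->
  cabs (dirichlet Q (- v)) ^+ 2 <= (sin (pi * d) ^+ 2)^-1.
Proof.
move=> /andP[d0 d1] /andP[dv v1].
have sd : 0 < sin (pi * d).
  by apply: sin_gt0_pi; rewrite mulr_gt0 ?pi_gt0//= gtr_pMr// pi_gt0.
have E : (expi (2 * pi * - v) - 1) * dirichlet Q (- v) =
    expi (2 * pi * (Q%:R * - v)) - 1.
  have -> : expi (2 * pi * (Q%:R * - v)) - 1 =
      expi (2 * pi * - v) ^+ Q - 1 ^+ Q :> R[i].
    by rewrite -expiX expr1n; congr (expi _ - 1); ring.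
  rewrite subrXX; congr (_ * _).
  rewrite /dirichlet (reindex_inj rev_ord_inj)/=; apply: eq_bigr => q _.
  by rewrite -subn1 -subnDA add1n expr1n mulr1 -expiX; congr expi; ring.
have := congr1 (fun z => cabs z ^+ 2) E; rewrite cabs2M !cabs2_expiB1 => {}E.
have sv : sin (pi * d) ^+ 2 <= sin (pi * - v) ^+ 2.
  rewrite mulrN sinN sqrrN !sin2cos2 lerD2l lerN2 -real_normK ?num_real//.
  rewrite -[leRHS]real_normK ?num_real// ler_sqr ?nnegrE//.
  have cos_le (x y : R) :
      x \in `[0, pi] -> y \in `[0, pi] -> x <= y -> cos y <= cos x.
    move=> xI yI; rewrite le_eqVlt => /predU1P[->//|xy].
    by rewrite ltW// ltr_cos.
  have c0 : `|cos (pi * d)| >= cos (pi * d) by exact: ler_norm.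
  have ppos := @pi_gt0 R.
  have inI (w : R) : 0 <= w <= 1 -> pi * w \in `[0, pi].
    by move=> /andP[w0 w1]; rewrite in_itv/= mulr_ge0 ?pi_ge0//= ger_pMr.
  have dI : pi * d \in `[0, pi] by apply: inI; lra.
  have vI : pi * v \in `[0, pi] by apply: inI; lra.
  have d'I : pi * (1 - d) \in `[0, pi] by apply: inI; lra.
  have le1 : cos (pi * v) <= cos (pi * d) by apply: cos_le => //; rewrite ler_pM2l.
  have le2 : cos (pi * (1 - d)) <= cos (pi * v) by apply: cos_le => //; rewrite ler_pM2l.
  have E2 : cos (pi * (1 - d)) = - cos (pi * d).
    by rewrite mulrBr mulr1 -opprB cosN cosB cospi sinpi; ring.
  by apply: le_trans c0; rewrite ler_norml -E2 le2.
rewrite -[leRHS]mul1r ler_pdivlMr ?exprn_gt0//.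
set X := cabs _ ^+ 2 in E *.
have X0 : 0 <= X by rewrite sqr_ge0.
apply: (@le_trans _ _ (X * sin (pi * - v) ^+ 2)); first by rewrite ler_wpM2l.
have : sin (pi * (Q%:R * - v)) ^+ 2 <= 1 by rewrite sin2cos2 gerBl sqr_ge0.
lra.
Qed.

(** The partition of unity loses only tails when it is restricted to the q with
    q/Q < t: for the others, q/Q - v lies in [d, 1 - d]. *)
Lemma dirichlet_window Q d t v : (0 < Q)%N -> 0 < d < 1 -> d <= v <= t - d ->
  Q%:R ^+ 2 - Q%:R * (sin (pi * d) ^+ 2)^-1 <=
  \sum_(q < Q | q%:R < t * Q%:R) cabs (dirichlet Q (v - q%:R / Q%:R)) ^+ 2.
Proof.
move=> Q0 d01 /andP[dv vt].
rewrite -(dirichlet_partition v Q0) lerBlDr.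
rewrite [leLHS](bigID (fun q : 'I_Q => q%:R < t * Q%:R))/= lerD2l.
have Qp : 0 < Q%:R :> R by rewrite ltr0n.
have -> : Q%:R * (sin (pi * d) ^+ 2)^-1 = \sum_(q < Q) (sin (pi * d) ^+ 2)^-1.
  by rewrite sumr_const card_ord mulr_natl.
rewrite big_mkcond/=; apply: ler_sum => q _; case: ifPn; last first.
  by rewrite invr_ge0 sqr_ge0.
rewrite -leNgt -ler_pdivlMr// => tq.
have q1 : q%:R / Q%:R < 1 :> R by rewrite ltr_pdivrMr// mul1r ltr_nat.
rewrite -opprB; apply: dirichlet_tail => //; lra.
Qed.

Lemma count_lt Q t : 0 <= t -> \sum_(q < Q | q%:R < t) 1 <= t + 1.
Proof.
move=> t0; elim: Q => [|Q IH]; first by rewrite big_ord0 addr_ge0.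
rewrite big_mkcond big_ord_recr /= -big_mkcond/=.
case: ifPn => [Qt|_]; last by rewrite addr0.
rewrite lerD2r; apply: le_trans (ltW Qt).
rewrite -[leRHS]mulr1 mulr_natl -[X in _ *+ X](card_ord Q) -sumr_const big_mkcond/=.
by apply: ler_sum => q _; case: ifP.
Qed.

End DirichletKernel.

(** * From kernel averages to a pointwise bound *)

Section Localization.
Context {R : realType}.
Local Notation mu := (@lebesgue_measure R).
Variables (D : set R) (W : R -> R) (a b : R).
Hypotheses (mD : measurable D) (mW : measurable_fun D W) (W0 : forall x, 0 <= W x).
Hypotheses (a0 : 0 < a) (b0 : 0 <= b).
Hypothesis kernel_le : forall Q y,
  (\int[mu]_(x in D) (cabs (dirichlet Q (a * (x - y))) ^+ 2 * W x)%:E <=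
   (b * Q%:R)%:E)%E.

Lemma cmeasurable_dirichlet A Q y :
  cmeasurable A (fun x => dirichlet Q (a * (x - y))).
Proof.
apply: cmeasurable_sum => m.
rewrite (_ : (fun x => _) = fun x =>
    expi (- (2 * pi * m%:R * a * y)) * expi (2 * pi * m%:R * a * x)).
  by apply: cmeasurableM; [exact: cmeasurable_cst|exact: cmeasurable_expi].
by apply/funext => x; rewrite -expiD; congr expi; ring.
Qed.

Lemma integral_weight_le : (\int[mu]_(x in D) (W x)%:E <= b%:E)%E.
Proof.
have := kernel_le 1 0; rewrite mulr1; congr (_ <= _)%E.
apply: eq_integral => x _.
by rewrite /dirichlet big_ord1 mulr0 mul0r cabs2_expi mul1r.
Qed.

(** The grid of points y starts at x0 - h - e and its part with q < t Q covers the
    window enlarged by e on both sides; the kernels centred on it majorize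
    Q (Q - C) on the window, with C independent of Q. Hence the integral is at most
    a b (2 h + 2 e) in the limit of large Q, for every small e. *)
Lemma integral_window_le (x0 h : R) : 0 < h ->
  (\int[mu]_(x in D `&` `[(x0 - h)%R, (x0 + h)%R]) (W x)%:E <= (2 * a * b * h)%:E)%E.
Proof.
move=> h0; set B := `[(x0 - h)%R, (x0 + h)%R]%classic.
have mB : measurable B by exact: measurable_itv.
have mDB : measurable (D `&` B) by exact: measurableI.
have mWB : measurable_fun (D `&` B) W by exact: measurable_funS mW.
have IDB : (\int[mu]_(x in D `&` B) (W x)%:E <= b%:E)%E.
  apply: le_trans integral_weight_le; apply: ge0_subset_integral => //.
  - exact/measurable_EFinP.
  - by move=> x _; rewrite lee_fin.
have I0 : (0 <= \int[mu]_(x in D `&` B) (W x)%:E)%E.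
  by apply: integral_ge0 => x _; rewrite lee_fin.
have Ifin : (\int[mu]_(x in D `&` B) (W x)%:E)%E \is a fin_num.
  by rewrite ge0_fin_numE// (le_lt_trans IDB)// ltry.
set X := fine (\int[mu]_(x in D `&` B) (W x)%:E)%E.
have XE : (\int[mu]_(x in D `&` B) (W x)%:E = X%:E)%E by rewrite fineK.
have X0 : 0 <= X by rewrite fine_ge0.
rewrite XE lee_fin.
have main (e : R) Q : 0 < e -> a * e < 1 -> (0 < Q)%N ->
    (sin (pi * (a * e)) ^+ 2)^-1 <= Q%:R ->
    (Q%:R - (sin (pi * (a * e)) ^+ 2)^-1) * X <= b * (a * (2 * h + 2 * e) * Q%:R + 1).
  move=> e0 ae1 Q0; set C := _^-1 => CQ.
  set t := a * (2 * h + 2 * e).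
  have t0 : 0 <= t by rewrite /t mulr_ge0 ?(ltW a0)//; lra.
  have Qp : 0 < Q%:R :> R by rewrite ltr0n.
  pose y (q : nat) := x0 - h - e + q%:R / (a * Q%:R).
  pose s := [seq q : 'I_Q <- index_enum 'I_Q | q%:R < t * Q%:R].
  pose K (q : 'I_Q) x := cabs (dirichlet Q (a * (x - y q))) ^+ 2 * W x.
  have K0 q x : (0 <= (K q x)%:E)%E by rewrite lee_fin mulr_ge0// sqr_ge0.
  have mK q : measurable_fun D (fun x => (K q x)%:E).
    apply/measurable_EFinP; apply: measurable_funM => //.
    by apply: measurable_cabs2; exact: cmeasurable_dirichlet.
  have pw x : B x -> Q%:R * (Q%:R - C) * W x <= \sum_(q <- s) K q x.
    rewrite /B /= in_itv/= => /andP[x1 x2].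
    rewrite -mulr_suml ler_wpM2r//.
    pose v := a * (x - x0 + h + e).
    have dv : a * e <= v <= t - a * e.
      rewrite /v /t -mulrBr !ler_pM2l//; lra.
    have d01 : 0 < a * e < 1 by rewrite mulr_gt0.
    have := dirichlet_window Q0 d01 dv; rewrite -/C.
    have -> : Q%:R ^+ 2 - Q%:R * C = Q%:R * (Q%:R - C) by ring.
    move=> /le_trans; apply; rewrite le_eqVlt; apply/orP; left; apply/eqP.
    rewrite [RHS]big_filter; apply: eq_bigr => q _; congr (cabs (dirichlet _ _) ^+ 2).
    by rewrite /v /y; field; rewrite !gt_eqF.
  have : ((Q%:R * (Q%:R - C) * X)%:E <= (\sum_(q <- s) b * Q%:R)%:E)%E.
    rewrite EFinM -XE -ge0_integralZl//; last 3 first.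
    - exact/measurable_EFinP.
    - by move=> x _; rewrite lee_fin.
    - by rewrite lee_fin mulr_ge0// subr_ge0.
    apply: (@le_trans _ _ (\int[mu]_(x in D `&` B) (\sum_(q <- s) (K q x)%:E))%E).
      apply: ge0_le_integral => //.
      - by move=> x _; rewrite -EFinM lee_fin !mulr_ge0// subr_ge0.
      - by apply: emeasurable_funM => //; apply/measurable_EFinP.
      - apply: emeasurable_sum => q; exact: measurable_funS (mK q).
      - by move=> x [_ /pw]; rewrite -EFinM sumEFin lee_fin.
    apply: (@le_trans _ _ (\int[mu]_(x in D) (\sum_(q <- s) (K q x)%:E))%E).
      apply: ge0_subset_integral => //.
      - exact: emeasurable_sum.
      - by move=> x _; exact: sume_ge0.
    rewrite ge0_integral_sum// -sumEFin.
    by apply: lee_sum => q _; exact: kernel_le.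
  rewrite lee_fin.
  have -> : \sum_(q <- s) b * Q%:R = b * Q%:R * \sum_(q <- s) 1.
    by rewrite mulr_sumr; apply: eq_bigr => q _; rewrite mulr1.
  have cnt : \sum_(q <- s) 1 <= t * Q%:R + 1 by rewrite big_filter; apply: count_lt; rewrite mulr_ge0.
  move=> le1; rewrite -(ler_pM2l Qp) mulrA (le_trans le1)//.
  rewrite [b * Q%:R]mulrC -mulrA ler_pM2l//.
  by rewrite ler_wpM2l.
have limit (e : R) : 0 < e -> a * e < 1 -> X <= b * (a * (2 * h + 2 * e)).
  move=> e0 ae1; rewrite leNgt; apply/negP => lt.
  set C := (sin (pi * (a * e)) ^+ 2)^-1 in main.
  have C0 : 0 <= C by rewrite invr_ge0 sqr_ge0.
  set z := X - b * (a * (2 * h + 2 * e)).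
  have z0 : 0 < z by rewrite subr_gt0.
  (* Beyond this Q the excess z contradicts the bound of [main]. *)
  pose Q := (Num.truncn (C + (b + C * X) / z)).+1.
  have QC : C + (b + C * X) / z < Q%:R.
    exact: Num.Theory.truncnS_gt.
  have bC0 : 0 <= b + C * X by rewrite addr_ge0// mulr_ge0.
  have := main e Q e0 ae1 isT; rewrite -/C => /(_ _)/wrap[].
    by rewrite (le_trans _ (ltW QC))// lerDl divr_ge0// ltW.
  have : (b + C * X) / z < Q%:R by apply: le_lt_trans QC; rewrite lerDr.
  rewrite ltr_pdivrMr// /z; set T := a * _ => lt1 le1.
  nra.
apply/ler_addgt0Pl => e e0.
(* The first bound keeps a * d below 1, the second makes the loss at most e. *)
pose d := Num.min (1 / (2 * a)) (e / (2 * a * b + 1)).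
have ab0 : 0 <= 2 * a * b by rewrite !mulr_ge0// ltW.
have d0 : 0 < d.
  by rewrite lt_min !divr_gt0//= ?mulr_gt0// ltr_wpDl.
have ad1 : a * d < 1.
  apply: (@le_lt_trans _ _ (a * (1 / (2 * a)))).
    by rewrite ler_pM2l// ge_min lexx.
  by rewrite (_ : a * _ = 1 / 2); [lra|field; rewrite gt_eqF].
apply: le_trans (limit d d0 ad1) _.
have : 2 * a * b * d <= e.
  apply: (@le_trans _ _ ((2 * a * b + 1) * (e / (2 * a * b + 1)))).
    apply: ler_pM => //; [exact: ltW|by rewrite lerDl|].
    by rewrite ge_min lexx orbT.
  by rewrite mulrC divfK// gt_eqF// ltr_wpDl.
lra.
Qed.

End Localization.

Section DensityBound.
Context {R : realType}.
Local Notation mu := (@lebesgue_measure R).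

(** At a Lebesgue point x of D, an excess z = W x - c > 0 would force the average
    of W over small balls around x to exceed c. *)
Lemma ae_le_of_integral_window_le (D : set R) (W : R -> R) (c : R) :
  measurable D -> measurable_fun D W -> (forall x, 0 <= W x) ->
  (\int[mu]_(x in D) (W x)%:E < +oo)%E ->
  (forall x0 h : R, 0 < h ->
    (\int[mu]_(x in D `&` `[(x0 - h)%R, (x0 + h)%R]) (W x)%:E <=
      (2 * c * h)%:E)%E) ->
  {ae mu, forall x, D x -> W x <= c}.
Proof.
move=> mD mW W0 Wfin window.
have Wint : mu.-integrable D (EFin \o W).
  apply/integrableP; split; first exact/measurable_EFinP.
  by under eq_integral do rewrite /= ger0_norm//.
have locW := integrable_locally_restrict mD Wint.
have [mf _ _] := locW.
set f := W \_ D in locW mf.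
have := lebesgue_differentiation locW.
apply: filterS; first exact: (ae_filter_ringOfSetsType mu).
move=> x xpt Dx.
have fxE : f x = W x by rewrite /f patchE mem_set.
rewrite -fxE leNgt; apply/negP => cfx.
set z := f x - c.
have z0 : 0 < z by rewrite subr_gt0.
have [r /=] : exists r : R, 0 < r /\ (davg f x r < z%:E)%E.
  have near_z : \forall r \near (0 : R)^'+, (davg f x r < z%:E)%E.
    apply: (xpt [set y | y < z%:E]%E); apply: open_ereal_lt'.
    by rewrite lte_fin.
  have near_pos : \forall r \near (0 : R)^'+, 0 < r by exact: nbhs_right_gt.
  have [r [r0 rz]] := filter_ex (filterI near_pos near_z).
  by exists r.
move=> [r0 davg_lt].
have mB : measurable (ball x r) by exact: measurable_ball.
have muB : mu (ball x r) = (2 * r)%:E.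
  by rewrite lebesgue_measure_ball ?ltW// mulr2n; congr EFin; ring.
have mfB : measurable_fun (ball x r) f by exact: measurable_funS mf.
have mdiff : measurable_fun (ball x r) (fun y => `|f y - f x|).
  apply: measurableT_comp => //; apply: measurable_funB => //.
have f0 y : 0 <= f y by rewrite /f patchE; case: ifP.
have I1 : (\int[mu]_(y in ball x r) `|f y - f x|%:E < (z * (2 * r))%:E)%E.
  have r2 : 0 < 2 * r by rewrite mulr_gt0.
  move: davg_lt; rewrite /davg /iavg muB inver gt_eqF//=.
  by rewrite lte_pdivrMl// -EFinM [2 * r * z]mulrC.
have I2 : (\int[mu]_(y in ball x r) (f y)%:E <= (2 * c * r)%:E)%E.
  apply: le_trans (window x r r0).
  rewrite [leRHS]integral_mkcondl.
  have -> : (fun y => (W y)%:E) \_ D = EFin \o f by exact: restrict_EFin.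
  apply: ge0_subset_integral => //.
  - apply/measurable_EFinP; exact: measurable_funS mf.
  - by move=> y _; rewrite lee_fin.
  - by rewrite ball_itv; exact: subset_itvW.
have : ((f x * (2 * r))%:E <= \int[mu]_(y in ball x r) `|f y - f x|%:E +
    \int[mu]_(y in ball x r) (f y)%:E)%E.
  rewrite -ge0_integralD//; last 3 first.
  - exact/measurable_EFinP.
  - by move=> y _; rewrite lee_fin.
  - exact/measurable_EFinP.
  rewrite EFinM -muB -integral_cst//; apply: ge0_le_integral => //.
  - by move=> y _; rewrite lee_fin.
  - by apply: emeasurable_funD; exact/measurable_EFinP.
  - move=> y _; rewrite -EFinD lee_fin -lerBlDr distrC; exact: ler_norm.
apply/negP; rewrite -ltNge.
apply: (@lt_le_trans _ _ ((z * (2 * r))%:E + (2 * c * r)%:E)%E).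
  apply: lte_leD => //; rewrite ge0_fin_numE ?(le_lt_trans I2) ?ltry//.
  by apply: integral_ge0 => y _; rewrite lee_fin.
by rewrite -EFinD lee_fin /z; lra.
Qed.

End DensityBound.

Lemma modulator_dirichlet (R : realType) N r Q (y x : R) :
  modulator N r (fun q : 'I_Q => expi (- (2 * pi * q%:R * (4 * N%:R * y)))) x =
  dirichlet Q (4 * N%:R * (x - y)).
Proof.
apply: eq_bigr => q _; rewrite -expiD /=; congr expi.
by rewrite (_ : (nat_of_ord q)%:~R = q%:R :> R)//; ring.
Qed.

Theorem theorem2p8 (R : realType) (n N r p : nat)
    (fs : 'I_p -> Lambda R N r -> 'M[R[i]]_n) (b0 : R)
    (Fs : 'I_p -> R -> 'M[R[i]]_n) :
  (0 < n)%N -> (0 < N)%N -> odd r -> coprime r N ->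
  (1 <= r <= 2 * N - 1)%N -> (0 < p)%N ->
  (forall j, ell2 (fs j)) ->
  (forall j, fs j <> (fun=> 0)) ->
  is_bessel_sequence fs b0 ->
  (forall j, is_fourier_transform (fs j) (Fs j)) ->
  {ae lebesgue_measure, forall x : R, Omega R N x ->
     forall j : 'I_p, mxFnorm (Fs j x) <= N%:R + b0}.
Proof.
move=> _ N0 r_odd _ _ _ fs2 _ bessel fFs.
have b0_gt0 : 0 < b0 := bessel.1.
have Np : 0 < N%:R :> R by rewrite ltr0n.
have aj j : {ae (@lebesgue_measure R), forall x : R, Omega R N x ->
    mxnorm2 (Fs j x) <= 4 * N%:R * b0}.
  have mO := @measurable_Omega R N.
  have mW : measurable_fun (Omega R N) (fun x => mxnorm2 (Fs j x)).
    apply: measurable_sum => m; apply: measurable_sum => k.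
    by apply: measurable_cabs2; have [[]] := fFs j m k.
  have W0 x : 0 <= mxnorm2 (Fs j x) := mxnorm2_ge0 _.
  have a0 : 0 < 4 * N%:R :> R by rewrite mulr_gt0.
  have kernel_le Q y : (\int[lebesgue_measure]_(x in Omega R N)
      (cabs (dirichlet Q (4 * N%:R * (x - y))) ^+ 2 * mxnorm2 (Fs j x))%:E <=
      (b0 * Q%:R)%:E)%E.
    under eq_integral do rewrite -(modulator_dirichlet N r).
    by apply: modulated_energy_le bessel _ _ _ => // q; exact: cabs2_expi.
  apply: ae_le_of_integral_window_le => //.
    by apply: le_lt_trans (integral_weight_le kernel_le) _; rewrite ltry.
  move=> x0 h h0.
  have := integral_window_le mO mW W0 a0 (ltW b0_gt0) kernel_le x0 h0.
  by move=> /le_trans; apply; rewrite lee_fin; lra.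
have : {ae (@lebesgue_measure R), forall x j, Omega R N x ->
    mxnorm2 (Fs j x) <= 4 * N%:R * b0}.
  apply: (@filter_forall _ _ _ _
    (ae_filter_ringOfSetsType (@lebesgue_measure R))) => j.
  exact: aj.
apply: filterS; first exact: (ae_filter_ringOfSetsType (@lebesgue_measure R)).
move=> x xj Ox j.
have Nb0 : 0 <= N%:R + b0 by rewrite addr_ge0 ?ltW.
rewrite /mxFnorm -[leRHS]ger0_norm// -sqrtr_sqr ler_wsqrtr//.
(* 4 N b0 <= (N + b0)^2 because the difference is (N - b0)^2. *)
apply: le_trans (xj j Ox) _; rewrite -subr_ge0.
by rewrite (_ : _ - _ = (N%:R - b0) ^+ 2) ?sqr_ge0//; ring.
Qed.
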